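(* Let $h>0$ and let $\chi^0\colon\mathbb{R}^d\to\{0,1\}$ with $\int\chi^0\,dx=1$. Let $\phi$, $\lambda$ and $\chi^1$ be obtained by one step of the volume-preserving thresholding scheme, i.e. $\phi=G_h\ast\chi^0$, $\lambda$ is such that $|\{\phi>\lambda\}|=1$, and $\chi^1=\mathbf 1_{\{\phi>\lambda\}}$. Then $\chi^1$ solves $$\min\quad E_h(\chi)+D_h(\chi-\chi^0)+\frac{2\lambda-1}{\sqrt h}\int\chi\,dx,$$ where the minimum runs over all $\chi\colon\mathbb{R}^d\to\{0,1\}$ (measurable with $\int\chi\,dx<\infty$). Or equivalently, $\chi^1$ solves $$\min\quad E_h(\chi)+D_h(\chi-\chi^0)\quad\text{subject to}\quad\int\chi\,dx=1,\quad\chi\in\{0,1\}.$$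
   Context: Integrals are over $\mathbb{R}^d$. Heat kernel: $G_h(z)=(4\pi h)^{-d/2}\exp(-|z|^2/(4h))$. $E_h(\chi)=\frac1{\sqrt h}\int(1-\chi)\,G_h\ast\chi\,dx$ for $\chi\colon\mathbb{R}^d\to\{0,1\}$; $D_h(\omega)=\frac1{\sqrt h}\int\omega\,G_h\ast\omega\,dx$ for $\omega\colon\mathbb{R}^d\to\{-1,0,1\}$. It is understood that a threshold $\lambda$ as in the claim exists. *)

(* Defs.v *)
From HB Require Import structures.
From mathcomp Require Import all_boot all_order all_algebra.
From mathcomp Require Import all_classical all_reals all_analysis.

Set Implicit Arguments.
Unset Strict Implicit.
Unset Printing Implicit Defensive.

Import Order.TTheory GRing.Theory Num.Theory.

Local Open Scope classical_set_scope.
Local Open Scope ring_scope.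

Section borel_lebesgue.
Context {R : realType}.

Local Notation borelRd d := (d.-tuple (measurableTypeR R)).

Definition consRd (n : nat) (p : measurableTypeR R * borelRd n) : borelRd n.+1 :=
  [the n.+1.-tuple (measurableTypeR R) of p.1 :: p.2].

Lemma measurable_consRd n : measurable_fun setT (@consRd n).
Proof. exact: measurable_cons. Qed.

Section step.
Context (n : nat) (mu : {sigma_finite_measure set (borelRd n) -> \bar R}).

Local Notation prod_mu := ((@lebesgue_measure R) \x mu)%E.

Definition borel_lebesgueS : set (borelRd n.+1) -> \bar R :=
  pushforward prod_mu (@consRd n).

Let measurable_preimage (A : set (borelRd n.+1)) :
  measurable A -> measurable (@consRd n @^-1` A).
Proof.
by move=> mA; rewrite -[X in measurable X]setTI; exact: measurable_consRd.
Qed.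

Let borel_lebesgueS0 : borel_lebesgueS set0 = 0%E.
Proof. by rewrite /borel_lebesgueS /pushforward preimage_set0 measure0. Qed.

Let borel_lebesgueS_ge0 A : (0 <= borel_lebesgueS A)%E.
Proof. by rewrite /borel_lebesgueS /pushforward; exact: measure_ge0. Qed.

Let borel_lebesgueS_sigma_additive : semi_sigma_additive borel_lebesgueS.
Proof.
move=> F mF tF mUF; rewrite /borel_lebesgueS /pushforward preimage_bigcup.
apply: measure_semi_sigma_additive.
- by move=> k; exact: measurable_preimage.
- apply/trivIsetP => /= i j _ _ ij; rewrite -preimage_setI.
  by move/trivIsetP : tF => /(_ _ _ _ _ ij) ->//; rewrite preimage_set0.
- by rewrite -preimage_bigcup; exact: measurable_preimage.
Qed.

HB.instance Definition _ := isMeasure.Build _ _ _ borel_lebesgueS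
  borel_lebesgueS0 borel_lebesgueS_ge0 borel_lebesgueS_sigma_additive.

Let borel_lebesgueS_sigma_finite : sigma_finite setT borel_lebesgueS.
Proof.
have /sigma_finiteP[F [TF ndF Foo]] := sigma_finiteT (@lebesgue_measure R).
have /sigma_finiteP[G [TG ndG Goo]] := sigma_finiteT mu.
pose unconsRd (x : borelRd n.+1) : measurableTypeR R * borelRd n :=
  (tnth x ord0, [tuple of behead x]).
have unconsK : cancel (@consRd n) unconsRd.
  by move=> [x t]; congr pair; apply: val_inj.
have consK : cancel unconsRd (@consRd n).
  by move=> x; rewrite [RHS]tuple_eta.
have munconsRd : measurable_fun setT unconsRd.
  apply/measurable_fun_pairP; split.
    exact: measurable_tnth.
  exact: measurable_behead.
exists (fun k => unconsRd @^-1` (F k `*` G k)).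
  rewrite -preimage_bigcup (_ : \bigcup_k _ = setT) ?preimage_setT//.
  rewrite -setXTT TF TG predeqE => -[x y]; split.
    by move=> [k _ []/= ? ?]; split; exists k.
  move=> [/= [k _ Fkx] [l _ Gly]]; exists (maxn k l) => //; split.
  - by move: x Fkx; exact/subsetPset/ndF/leq_maxl.
  - by move: y Gly; exact/subsetPset/ndG/leq_maxr.
move=> k; have [mFk Fkoo] := Foo k; have [mGk Gkoo] := Goo k; split.
  by rewrite -[X in measurable X]setTI; apply: munconsRd => //; exact: measurableX.
rewrite /borel_lebesgueS /pushforward -comp_preimage.
rewrite (_ : _ \o _ = id) ?preimage_id; last exact/funext.
by rewrite product_measure1E// lte_mul_pinfty// ge0_fin_numE.
Qed.

HB.instance Definition _ := Measure_isSigmaFinite.Build _ _ _ borel_lebesgueS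
  borel_lebesgueS_sigma_finite.

End step.

(* d-fold product of the one-dimensional Lebesgue measure, on Borel sets;
   R^0 is a single point of mass 1. *)
Fixpoint borel_lebesgue (d : nat) :
    {sigma_finite_measure set (borelRd d) -> \bar R} :=
  match d return {sigma_finite_measure set (borelRd d) -> \bar R} with
  | 0 => @dirac _ (borelRd 0) [tuple] R
  | n.+1 => borel_lebesgueS (borel_lebesgue n)
  end.

End borel_lebesgue.

(* R^d with its Lebesgue (not only Borel) measurable sets: the Caratheodory
   sigma-algebra of the outer measure induced by the product measure. *)
Definition Rd (R : realType) (d : nat) : measurableType _ :=
  caratheodory_type ((@borel_lebesgue R d)^*)%mu.

Section functionals.
Context {R : realType} {d : nat}.
Local Notation Rd := (Rd R d).
Implicit Types (h : R) (x y z : Rd) (f g chi omega : Rd -> R).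

Definition lebesgueRd : {measure set Rd -> \bar R} :=
  @completed_measure_extension _ _ R (@borel_lebesgue R d).

Definition coordRd x (i : 'I_d) : R := @tnth d R x i.

Definition subRd x y : Rd := [tuple coordRd x i - coordRd y i | i < d].

Definition sqnormRd z : R := \sum_(i < d) coordRd z i ^+ 2.

Definition heat_kernel h z : R :=
  (4 * pi * h) `^ (- (d%:R / 2)) * expR (- (sqnormRd z / (4 * h))).

(* Only used with f = heat_kernel h, h > 0, and g bounded and measurable, where
   the real-valued integral is that of an integrable function. *)
Definition convRd f g x : R := \int[lebesgueRd]_y (f (subRd x y) * g y).

Definition energy h chi : \bar R :=
  ((Num.sqrt h)^-1%:E *
   \int[lebesgueRd]_x ((1 - chi x) * convRd (heat_kernel h) chi x)%:E)%E.

Definition dissipation h omega : \bar R :=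
  ((Num.sqrt h)^-1%:E *
   \int[lebesgueRd]_x (omega x * convRd (heat_kernel h) omega x)%:E)%E.

Definition characteristic chi : Prop :=
  measurable_fun setT chi /\ forall x, chi x = 0 \/ chi x = 1.

Definition volume chi : \bar R := (\int[lebesgueRd]_x (chi x)%:E)%E.

End functionals.

Definition minimizes {R : realType} {T : Type} (A : set T) (F : T -> \bar R)
    (u : T) : Prop :=
  A u /\ forall v, A v -> (F u <= F v)%E.

(* Main.v *)
Require Import Defs.
From HB Require Import structures.
From mathcomp Require Import all_boot all_order all_algebra.
From mathcomp Require Import all_classical all_reals all_analysis.
From mathcomp Require Import measurable_realfun.
From mathcomp Require Import ring lra.

Set Implicit Arguments.
Unset Strict Implicit.
Unset Printing Implicit Defensive.

Import Order.TTheory GRing.Theory Num.Theory.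

Local Open Scope classical_set_scope.
Local Open Scope ring_scope.

(** Write K for the convolution with the heat kernel and <f, g> for the integral
  of f * K g. Since K is symmetric and preserves the integral, the quadratic
  term <chi, chi> cancels in

    sqrt h * (E_h(chi) + D_h(chi - chi0))
      = int chi - 2 <chi, chi0> + <chi0, chi0>,

  so that adding (2 lambda - 1) int chi leaves
  2 * int chi * (lambda - K chi0) + <chi0, chi0>. The latter is minimized
  pointwise by the indicator of {lambda < K chi0}; under a volume constraint
  the added term is constant. *)

Lemma EFin_Rintegral d (T : measurableType d) (R : realType)
    (mu : {measure set T -> \bar R}) (f : T -> R) :
  mu.-integrable setT (EFin \o f) ->
  (\int[mu]_x f x)%:E = (\int[mu]_x (f x)%:E)%E.
Proof. by move=> intf; rewrite fineK//; exact: integrable_fin_num. Qed.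

(** * Quadratic forms of symmetric Markov kernels *)

Section symmetric_markov_kernel.
Context (d : measure_display) (T : measurableType d) (R : realType).
Variables (mu : {sigma_finite_measure set T -> \bar R}) (k : T -> T -> R).
Hypothesis measurable_k : measurable_fun setT (fun z : T * T => k z.1 z.2).
Hypothesis k_ge0 : forall x y, 0 <= k x y.
Hypothesis k_sym : forall x y, k x y = k y x.
Hypothesis int_k : forall y, (\int[mu]_x (k x y)%:E = 1)%E.
Implicit Types f g chi : T -> R.

Definition markov_op f x : R := \int[mu]_y (k x y * f y).

Definition pairing f g : R := \int[mu]_x (f x * markov_op g x).

(** The bound 1 lets [k x y] dominate [k x y * f y] and [markov_op g] dominate [f * markov_op g].
    Differences may leave this class, so they are expanded by linearity before integrating. *)
Definition bounded_integrable f :=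
  mu.-integrable setT (EFin \o f) /\ forall x, `|f x| <= 1.

Lemma bounded_integrable_measurable f :
  bounded_integrable f -> measurable_fun setT f.
Proof. by case=> /integrableP[/measurable_EFinP]. Qed.

Let measurable_kx x : measurable_fun setT (k x).
Proof. exact: (measurableT_comp measurable_k (measurable_pair1 x)). Qed.

Lemma kernelM_integrable f x : bounded_integrable f ->
  mu.-integrable setT (fun y => (k x y * f y)%:E).
Proof.
move=> bf; apply: (@le_integrable _ _ _ mu setT measurableT _ (EFin \o k x)).
- apply/measurable_EFinP; apply: measurable_funM => //.
  exact: bounded_integrable_measurable.
- move=> y _ /=; rewrite lee_fin normrM ler_piMr//.
  exact: bf.2.
- apply/integrableP; split; first exact/measurable_EFinP.
  under eq_integral do rewrite /= ger0_norm// k_sym.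
  by rewrite int_k ltry.
Qed.

Lemma markov_opE f x : bounded_integrable f ->
  (markov_op f x)%:E = (\int[mu]_y (k x y * f y)%:E)%E.
Proof. by move=> bf; apply: EFin_Rintegral; exact: kernelM_integrable. Qed.

Lemma markov_opB f g x : bounded_integrable f -> bounded_integrable g ->
  markov_op (f \- g) x = markov_op f x - markov_op g x.
Proof.
move=> bf bg; rewrite /markov_op -RintegralB//; last 2 first.
- exact: kernelM_integrable.
- exact: kernelM_integrable.
by apply: eq_Rintegral => y _ /=; rewrite mulrBr.
Qed.

(** Tonelli, integrating in the first variable first: the kernel has mass 1 there, so what remains
    is the integral of [|f y|]. *)
Lemma kernelM_integrable_prod f : bounded_integrable f ->
  (mu \x mu)%E.-integrable setT (fun z => (k z.1 z.2 * f z.2)%:E).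
Proof.
move=> bf; have mf := bounded_integrable_measurable bf.
have mkf : measurable_fun setT (fun z : T * T => (k z.1 z.2 * f z.2)%:E).
  apply/measurable_EFinP; apply: measurable_funM => //.
  exact: measurableT_comp.
apply/(integrable21ltyP _ _ mkf).
have [/integrableP[_ intf] _] := bf.
rewrite (eq_integral (fun y => `|(f y)%:E|%E))// => y _ /=.
under eq_integral do rewrite normrM ger0_norm// mulrC EFinM.
rewrite ge0_integralZl ?int_k ?mule1//.
- apply/measurable_EFinP; have := measurable_kx y.
  by under eq_fun do rewrite k_sym.
- by move=> x _; rewrite lee_fin.
Qed.

Lemma markov_op_integrable f : bounded_integrable f ->
  mu.-integrable setT (EFin \o markov_op f).
Proof.
move=> bf; have := integrable_fubini_F (kernelM_integrable_prod bf).
by apply: eq_integrable => // x _; rewrite /= markov_opE.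
Qed.

(** Conservation of mass: after Fubini the inner integral falls on the kernel alone and equals 1. *)
Lemma Rintegral_markov_op f : bounded_integrable f ->
  \int[mu]_x markov_op f x = \int[mu]_x f x.
Proof.
move=> bf; apply: EFin_inj; rewrite !EFin_Rintegral//; last 2 first.
- exact: bf.1.
- exact: markov_op_integrable.
under eq_integral do rewrite markov_opE//.
rewrite (Fubini (kernelM_integrable_prod bf)); apply: eq_integral => y _ /=.
under eq_integral do rewrite mulrC EFinM.
rewrite integralZl//= ?int_k ?mule1//.
apply/integrableP; split.
  apply/measurable_EFinP; have := measurable_kx y.
  by under eq_fun do rewrite k_sym.
under eq_integral do rewrite /= ger0_norm//.
by rewrite int_k ltry.
Qed.

Lemma pairing_integrable f g : bounded_integrable f -> bounded_integrable g ->
  mu.-integrable setT (EFin \o (fun x => f x * markov_op g x)).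
Proof.
move=> bf bg; have intKg := markov_op_integrable bg.
apply: le_integrable intKg => //.
- apply/measurable_EFinP; apply: measurable_funM.
    exact: bounded_integrable_measurable.
  by apply/measurable_EFinP; case/integrableP: (markov_op_integrable bg).
- by move=> x _ /=; rewrite lee_fin normrM ler_piMl//; exact: bf.2.
Qed.

(** Fubini and the symmetry of [k]; the double integrand is dominated by that of
    [kernelM_integrable_prod], as [|f| <= 1]. *)
Lemma pairingC f g : bounded_integrable f -> bounded_integrable g ->
  pairing f g = pairing g f.
Proof.
move=> bf bg.
have mf := bounded_integrable_measurable bf.
have mg := bounded_integrable_measurable bg.
have intfkg :
    (mu \x mu)%E.-integrable setT (fun z => (f z.1 * (k z.1 z.2 * g z.2))%:E).
  apply: le_integrable (kernelM_integrable_prod bg) => //.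
    apply/measurable_EFinP; apply: measurable_funM.
      exact: measurableT_comp.
    by apply: measurable_funM => //; exact: measurableT_comp.
  by move=> z _ /=; rewrite lee_fin normrM ler_piMl//; exact: bf.2.
have E u v x : bounded_integrable v ->
    (u x * markov_op v x)%:E = (\int[mu]_y (u x * (k x y * v y))%:E)%E.
  move=> bv; rewrite EFinM markov_opE// -integralZl//.
  exact: kernelM_integrable.
apply: EFin_inj; rewrite !EFin_Rintegral; try exact: pairing_integrable.
under eq_integral do rewrite E//.
under [RHS]eq_integral do rewrite E//.
rewrite (Fubini intfkg); apply: eq_integral => y _ /=.
by apply: eq_integral => x _; rewrite (k_sym x y); congr EFin; ring.
Qed.

(** By conservation of mass the first integral is the mass of [chi] minus [pairing chi chi]. The
    second one gives this pairing back, and symmetry merges its two cross terms. *)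
Lemma energy_dissipationE chi chi0 :
  bounded_integrable chi -> bounded_integrable chi0 ->
  ((\int[mu]_x ((1 - chi x) * markov_op chi x)%:E)
   + (\int[mu]_x ((chi \- chi0) x * markov_op (chi \- chi0) x)%:E))%E
  = (\int[mu]_x chi x - 2 * pairing chi chi0 + pairing chi0 chi0)%:E.
Proof.
move=> b b0.
have iP := pairing_integrable b b; have iP0 := pairing_integrable b b0.
have iP1 := pairing_integrable b0 b; have iP00 := pairing_integrable b0 b0.
have iK := markov_op_integrable b.
under eq_integral do rewrite mulrBl mul1r EFinB.
under [X in (_ + X)%E]eq_integral do
  rewrite /= markov_opB// mulrBl !mulrBr !EFinB.
rewrite !integralB//; try exact: integrableB.
rewrite -!EFin_Rintegral// Rintegral_markov_op//.
rewrite -!EFinB -EFinD -/(pairing _ _) -/(pairing _ _) -/(pairing _ _).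
rewrite -/(pairing _ _) (pairingC b0 b); congr EFin.
move: (pairing chi chi) (pairing chi chi0) (pairing chi0 chi0) => p q r.
by move: (\int[mu]_x chi x) => v; ring.
Qed.

(** Bathtub principle: both sides integrate [u * (lambda - markov_op chi0)], so it suffices to
    compare integrands. Competitors may take any value in [0, 1]. *)
Lemma thresholding_le chi chi0 lambda :
  bounded_integrable chi -> bounded_integrable chi0 ->
  (forall x, 0 <= chi x <= 1) ->
  let chi1 := \1_[set x | lambda < markov_op chi0 x] in
  bounded_integrable chi1 ->
  lambda * \int[mu]_x chi1 x - pairing chi1 chi0 <=
  lambda * \int[mu]_x chi x - pairing chi chi0.
Proof.
move=> b b0 chi01 chi1 b1.
have E u : bounded_integrable u ->
    mu.-integrable setT
      (EFin \o (fun x => lambda * u x - u x * markov_op chi0 x)) /\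
    lambda * \int[mu]_x u x - pairing u chi0 =
    \int[mu]_x (lambda * u x - u x * markov_op chi0 x).
  move=> bu; have iP := pairing_integrable bu b0.
  have iu : mu.-integrable setT (EFin \o (fun x => lambda * u x)).
    exact: eq_integrable (integrableZl measurableT lambda bu.1).
  split; first exact: eq_integrable (integrableB measurableT iu iP).
  by rewrite RintegralB// RintegralZl//; exact: bu.1.
rewrite (E _ b).2 (E _ b1).2; apply: le_Rintegral => //.
- exact: (E _ b1).1.
- exact: (E _ b).1.
move=> x _; rewrite /chi1 indicE; have /andP[c0 c1] := chi01 x.
(* On the superlevel set the factor [lambda - markov_op chi0 x] is negative and the largest value 1
   is best; off it the factor is nonnegative and 0 is best. *)
have [/set_mem/= lt|/negP] := boolP (x \in _).
  by rewrite /=; nra.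
rewrite inE/= => /negP; rewrite -leNgt => le.
by rewrite /=; nra.
Qed.

End symmetric_markov_kernel.

(** * Integration of coordinate products, and passage from Borel to Lebesgue sets *)

Lemma measurable_prod_tnth (R : realType) (d : nat)
    (f : 'I_d -> measurableTypeR R -> R) :
  (forall i, measurable_fun setT (f i)) ->
  measurable_fun setT (fun x : d.-tuple (measurableTypeR R) =>
    \prod_(i < d) f i (tnth x i)).
Proof.
move=> mf; apply: measurable_prod => i _.
by apply: measurableT_comp => //; exact: measurable_tnth.
Qed.

(** Induction on the dimension: Tonelli splits off the first coordinate. In dimension 0 the empty
    product is integrated against a Dirac mass. *)
Lemma integral_borel_lebesgue_prod (R : realType) (d : nat)
    (f : 'I_d -> measurableTypeR R -> R) :
  (forall i, measurable_fun setT (f i)) -> (forall i t, 0 <= f i t) ->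
  (forall i, (\int[lebesgue_measure]_t (f i t)%:E)%E = 1%E) ->
  (\int[borel_lebesgue d]_x (\prod_(i < d) f i (tnth x i))%:E)%E = 1%E.
Proof.
elim: d f => [|d IH] f mf f0 intf.
  rewrite /= integral_dirac//; last first.
    by apply/measurable_EFinP; exact: measurable_prod_tnth.
  by rewrite big_ord0 mule1 diracT.
have /measurable_EFinP mprod := measurable_prod_tnth mf.
have /measurable_EFinP mprod' :=
  measurable_prod_tnth (fun i => mf (lift ord0 i)).
rewrite /= /borel_lebesgueS ge0_integral_pushforward//; first last.
- by move=> x _; rewrite lee_fin; exact: prodr_ge0.
- exact: measurable_consRd.
rewrite preimage_setT fubini_tonelli1/=; first last.
- by move=> x; rewrite lee_fin; exact: prodr_ge0.
- by apply: measurableT_comp => //; exact: measurable_consRd.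
rewrite -(intf ord0); apply: eq_integral => t _.
rewrite /fubini_F/= -[RHS]mule1 -(IH (fun i => f (lift ord0 i)))//.
rewrite -ge0_integralZl//; first last.
- by rewrite lee_fin.
- by move=> x _; rewrite lee_fin; exact: prodr_ge0.
apply: eq_integral => x _.
rewrite big_ord_recl -EFinM; congr (_ * _)%:E.
by apply: eq_bigr => i _; rewrite tnthS.
Qed.

Lemma lebesgueRd_sigma_finite (R : realType) (d : nat) :
  sigma_finite setT (@lebesgueRd R d).
Proof. exact/completed_measure_extension_sigma_finite/sigma_finiteT. Qed.

Lemma borel_measurable_Rd (R : realType) (d : nat)
    (A : set (d.-tuple (measurableTypeR R))) :
  measurable A -> measurable (A : set (Rd R d)).
Proof. exact: caratheodory_measurable_mu_ext. Qed.

Lemma measurable_coordRd (R : realType) (d : nat) (i : 'I_d) :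
  measurable_fun setT (fun x : Rd R d => coordRd x i).
Proof.
move=> _ B mB; apply: borel_measurable_Rd.
by apply: (@measurable_tnth _ (measurableTypeR R) d i).
Qed.

(** The identity from Lebesgue to Borel sets is measurable and pushes the completed measure forward
    to the product measure, so a change of variables applies. *)
Lemma ge0_integral_lebesgueRd (R : realType) (d : nat)
    (f : d.-tuple (measurableTypeR R) -> \bar R) :
  measurable_fun setT f -> (forall x, 0 <= f x)%E ->
  (\int[@lebesgueRd R d]_x f x = \int[borel_lebesgue d]_x f x)%E.
Proof.
move=> mf f0.
have mid : measurable_fun setT
    (id : Rd R d -> d.-tuple (measurableTypeR R)).
  by move=> _ B mB; rewrite setTI; exact: borel_measurable_Rd.
transitivity (\int[pushforward (@lebesgueRd R d)
   (id : Rd R d -> d.-tuple (measurableTypeR R))]_x f x)%E.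
  by rewrite ge0_integral_pushforward.
apply: eq_measure_integral => A mA _.
exact: measurable_mu_extE.
Qed.

(** * The heat kernel as a symmetric Markov kernel *)

Section heat_kernel.
Context {R : realType} {d : nat}.
Variable h : R.
Hypothesis h0 : 0 < h.
Implicit Types x y : Rd R d.

Lemma heat_kernel_subC x y :
  heat_kernel h (subRd x y) = heat_kernel h (subRd y x).
Proof.
rewrite /heat_kernel (_ : sqnormRd (subRd x y) = sqnormRd (subRd y x))//.
by apply: eq_bigr => i _; rewrite /coordRd !tnth_mktuple -opprB sqrrN.
Qed.

Lemma heat_kernel_ge0 x : 0 <= heat_kernel h x.
Proof. by rewrite mulr_ge0 ?powR_ge0 ?expR_ge0. Qed.

Lemma heat_kernel_prod x y : heat_kernel h (subRd x y) =
  \prod_(i < d) normal_pdf (coordRd y i) (Num.sqrt (2 * h)) (coordRd x i).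
Proof.
have s0 : Num.sqrt (2 * h) != 0 by rewrite sqrtr_eq0 -ltNge mulr_gt0.
have h2 : 0 <= 2 * h by rewrite mulr_ge0// ltW.
have h4 : 0 <= 4 * pi * h by rewrite !mulr_ge0 ?pi_ge0// ltW.
under eq_bigr do rewrite normal_pdfE//.
rewrite big_split/= /heat_kernel; congr (_ * _).
  rewrite prodr_const card_ord /normal_peak sqr_sqrtr//.
  rewrite (_ : 2 * h * pi *+ 2 = 4 * pi * h); last by ring.
  rewrite -powR12_sqrt// -powRN -powR_mulrn ?powR_ge0// -powRrM.
  by congr (_ `^ _); ring.
rewrite /normal_fun -expR_sum; congr expR.
rewrite /sqnormRd mulr_suml -sumrN; apply: eq_bigr => i _.
rewrite /coordRd tnth_mktuple sqr_sqrtr// mulNr.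
by congr (- (_ / _)); ring.
Qed.

Lemma measurable_heat_kernel_sub :
  measurable_fun setT
    (fun z : Rd R d * Rd R d => heat_kernel h (subRd z.1 z.2)).
Proof.
apply: measurable_funM => //.
apply: measurableT_comp => //; apply: measurableT_comp => //.
apply: measurable_funM => //.
rewrite /sqnormRd; apply: measurable_sum => i _; apply: measurable_funX.
under eq_fun do rewrite /coordRd tnth_mktuple -!/(coordRd _ i).
apply: measurable_funB.
- exact: (measurableT_comp (@measurable_coordRd R d i) measurable_fst).
- exact: (measurableT_comp (@measurable_coordRd R d i) measurable_snd).
- exact: measurableT.
Qed.

Lemma integral_heat_kernel y :
  (\int[lebesgueRd]_x (heat_kernel h (subRd x y))%:E = 1)%E.
Proof.
under eq_integral do rewrite heat_kernel_prod.
pose f i : measurableTypeR R -> R :=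
  normal_pdf (coordRd y i) (Num.sqrt (2 * h)).
have mf i : measurable_fun setT (f i) by exact: measurable_normal_pdf.
have f0 i t : 0 <= f i t by exact: normal_pdf_ge0.
have intf i : (\int[lebesgue_measure]_t (f i t)%:E)%E = 1%E.
  exact: integral_normal_pdf.
rewrite -(integral_borel_lebesgue_prod mf f0 intf).
rewrite -ge0_integral_lebesgueRd//; last first.
  by move=> x; rewrite lee_fin; exact: prodr_ge0.
by apply/measurable_EFinP; exact: measurable_prod_tnth.
Qed.

End heat_kernel.

(** * The thresholding step on R^d *)

Definition sigma_finite_lebesgueRd (R : realType) (d : nat) :
    {sigma_finite_measure set (Rd R d) -> \bar R} :=
  HB.pack (@completed_measure_extension _ _ R (borel_lebesgue d))
    (Measure_isSigmaFinite.Build _ _ _ (@lebesgueRd R d)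
       (@lebesgueRd_sigma_finite R d)).

(** Fubini requires a sigma-finite structure, which the type of [lebesgueRd] does not carry; the two
    measures agree on every set. *)
Lemma integral_lebesgueRdE (R : realType) (d : nat) (f : Rd R d -> \bar R) :
  (\int[lebesgueRd]_x f x = \int[sigma_finite_lebesgueRd R d]_x f x)%E.
Proof. by apply: eq_measure_integral => A _ _; exact: erefl. Qed.

Lemma characteristic_bounded_integrable (R : realType) (d : nat)
    (chi : Rd R d -> R) :
  characteristic chi -> (volume chi < +oo)%E ->
  bounded_integrable (sigma_finite_lebesgueRd R d) chi.
Proof.
move=> [mchi chi01] vol; split; last first.
  by move=> x; case: (chi01 x) => ->; rewrite ?normr0 ?normr1 ?ler01.
apply/integrableP; split; first exact/measurable_EFinP.
rewrite (eq_integral (fun x => (chi x)%:E)) => [//|x _ /=].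
by case: (chi01 x) => ->; rewrite ?normr0 ?normr1.
Qed.

Theorem lemma1p7 (R : realType) (d : nat) (h : R) (chi0 phi chi1 : Rd R d -> R)
    (lambda : R) :
  0 < h ->
  characteristic chi0 ->
  volume chi0 = 1%E ->
  phi = convRd (heat_kernel h) chi0 ->
  lebesgueRd [set x | lambda < phi x] = 1%E ->
  chi1 = \1_[set x | lambda < phi x] ->
  minimizes
    [set chi | characteristic chi /\ (volume chi < +oo)%E]
    (fun chi => energy h chi + dissipation h (chi \- chi0)%R
                + ((2 * lambda - 1) / Num.sqrt h)%:E * volume chi)%E
    chi1
  /\
  minimizes
    [set chi | characteristic chi /\ volume chi = 1%E]
    (fun chi => energy h chi + dissipation h (chi \- chi0)%R)%E
    chi1.
Proof.
move=> h0 char0 vol0 phiE vol1 chi1E.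
pose mu := sigma_finite_lebesgueRd R d.
(* Convolution with the heat kernel is [markov_op] for this [k]; the next four facts are the
   hypotheses on the kernel. *)
pose k (x y : Rd R d) := heat_kernel h (subRd x y).
have mk : measurable_fun setT (fun z : Rd R d * Rd R d => k z.1 z.2).
  exact: measurable_heat_kernel_sub.
have k0 x y : 0 <= k x y by exact: heat_kernel_ge0.
have kC x y : k x y = k y x by exact: heat_kernel_subC.
have k1 y : (\int[mu]_x (k x y)%:E = 1)%E by exact: integral_heat_kernel.
have b0 : bounded_integrable mu chi0.
  by apply: characteristic_bounded_integrable => //; rewrite vol0 ltry.
have convE f : convRd (heat_kernel h) f = markov_op mu k f.
  by apply/funext => x; congr fine; exact: integral_lebesgueRdE.
have phiK : phi = markov_op mu k chi0 by rewrite phiE convE.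
(* Measurability of [phi] makes its superlevel set measurable, hence [chi1] admissible. *)
have mphi : measurable_fun setT phi.
  rewrite phiK; apply/measurable_EFinP.
  exact: measurable_int (markov_op_integrable mk k0 kC k1 b0).
have mA : measurable [set x | lambda < phi x].
  rewrite -[X in measurable X]setTI.
  have := mphi measurableT `]lambda, +oo[%classic (measurable_itv _).
  by congr (measurable (_ `&` _)); apply/seteqP; split => x /=;
    rewrite in_itv/= andbT.
have char1 : characteristic chi1.
  rewrite chi1E; split; first exact: measurable_indic.
  by move=> x; rewrite indicE; case: (_ \in _); [right|left].
have volchi1 : volume chi1 = 1%E.
  by rewrite /volume chi1E integral_indic// setIT vol1.
have b1 : bounded_integrable mu chi1.
  by apply: characteristic_bounded_integrable => //; rewrite volchi1 ltry.
pose c := pairing mu k chi0 chi0.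
pose v chi : R := \int[mu]_x chi x.
have volE chi : bounded_integrable mu chi -> volume chi = (v chi)%:E.
  move=> bchi.
  by rewrite EFin_Rintegral ?bchi.1// /volume integral_lebesgueRdE.
have EDE chi : bounded_integrable mu chi ->
    (energy h chi + dissipation h (chi \- chi0)%R =
     ((Num.sqrt h)^-1 * (v chi - 2 * pairing mu k chi chi0 + c))%:E)%E.
  move=> bchi; have E := energy_dissipationE mk k0 kC k1 bchi b0.
  (* Distributing the factor over a sum in the extended reals requires the sum to be defined; by [E]
     it is finite, hence so are both terms. *)
  have defE :
      ((\int[mu]_x ((1 - chi x) * markov_op mu k chi x)%:E) +?
       (\int[mu]_x
          ((chi \- chi0) x * markov_op mu k (chi \- chi0) x)%:E))%E.
    apply: fin_num_adde_defr.
    have := congr1 (fun z => z \is a fin_num) E.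
    by rewrite fin_numD => /andP[].
  rewrite /energy /dissipation !convE.
  rewrite [X in (_ * X + _)%E]integral_lebesgueRdE.
  rewrite [X in (_ + _ * X)%E]integral_lebesgueRdE.
  by rewrite -(muleDr _ defE)// E -EFinM.
have s0 : 0 < (Num.sqrt h)^-1 by rewrite invr_gt0 sqrtr_gt0.
have key chi : characteristic chi -> (volume chi < +oo)%E ->
    lambda * v chi1 - pairing mu k chi1 chi0 <=
    lambda * v chi - pairing mu k chi chi0.
  move=> char vol; move: b1; rewrite chi1E phiK => b1.
  apply: (thresholding_le mk k0 kC k1) => //.
    exact: characteristic_bounded_integrable.
  by move=> x; case: char => _ /(_ x)[] ->; rewrite ?lexx ?ler01.
split; split.
- by split => //; rewrite volchi1 ltry.
- move=> chi [char vol].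
  have bchi := characteristic_bounded_integrable char vol.
  have := key _ char vol.
  rewrite [X in (X + _ <= _)%E](EDE _ b1) [X in (_ <= X + _)%E](EDE _ bchi).
  rewrite (volE _ b1) (volE _ bchi).
  rewrite -!EFinM -!EFinD lee_fin => le1.
  (* The [-1] in [2 * lambda - 1] cancels the volume term of [EDE], and [c] drops out: the gap
     between the two functionals is [2 / sqrt h] times that of [key]. *)
  rewrite -subr_ge0 (_ : _ - _ = (Num.sqrt h)^-1 * 2 *
    ((lambda * v chi - pairing mu k chi chi0) -
     (lambda * v chi1 - pairing mu k chi1 chi0))); last by ring.
  by rewrite mulr_ge0 ?subr_ge0// mulr_ge0// ltW.
- by [].
- move=> chi [char vol].
  have vollt : (volume chi < +oo)%E by rewrite vol ltry.
  have bchi := characteristic_bounded_integrable char vollt.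
  (* With equal volumes the [lambda] terms of [key] cancel, and only the pairings with [chi0] are
     compared. *)
  have ev : v chi = v chi1 by apply: EFin_inj; rewrite -!volE// vol volchi1.
  rewrite [leLHS](EDE _ b1) [leRHS](EDE _ bchi) lee_fin ev.
  have := key _ char vollt; rewrite ev => le1.
  by rewrite ler_pM2l//; lra.
Qed.
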